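(* Let $G$ be a group acting by isometries on a $\delta$-hyperbolic geodesic metric space $X$ ($\delta>0$), and let $\mathcal{C}=(C,\{G_c\mid c\in C\})$ be a $\rho$-separated fairly rotating family with $\rho\ge 20\delta$. Fix $R$ with $2+2\delta\le R\le \frac{\rho}{2}-3\delta$, and let $\mathcal{Y}=\{S_p\}_{p\in C}$ with projections $\pi_p$ as defined in the context. Then for $\theta\ge 121\delta$, the group $G$ acts by isometries on a projection complex associated to the family $(\mathcal{Y},\{\pi_p\}_{p\in C})$ (upgraded so as to satisfy the strong projection axioms with constant $\theta$). Moreover, the family of subgroups $\{G_c\}_{c\in C}$ is an $L$-spinning family for this action, with $$L=2^{\frac{R-2}{\delta}}-4-248\delta.$$
   Context: A geodesic metric space $X$ is $\delta$-hyperbolic if every geodesic triangle is $\delta$-thin: for the map $\chi_\Delta$ from a triangle $\Delta$ to its comparison tripod (isometric on each side), any two points with the same image are at distance $\le\delta$. $B_R(p)$ denotes the open ball of radius $R$ about $p$. A rotating family $\mathcal{C}=(C,\{G_c\mid c\in C\})$ for an isometric action of $G$ on $X$ consists of a subset $C\subseteq X$ (apices) and subgroups $G_c\le G$ such that: $C$ is $G$-invariant; each $G_c$ fixes $c$; and $G_{gc}=gG_cg^{-1}$ for all $g\in G$, $c\in C$. It is $\rho$-separated if distinct apices are at distance at least $\rho$. It is fairly rotating if for all $c\in C$, all $g\in G_c\setminus\{1\}$ and all $x\in C$ with $x\ne c$, there is a geodesic from $x$ to $gx$ meeting the closed ball of radius $1$ about $c$. For $p\in C$, $S_p=\{x\in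 X: d(x,p)=R\}$, equipped with the metric $d_{S_p}(x,y)=$ infimum of lengths of paths from $x$ to $y$ in $X\setminus B_R(p)$ ($=\infty$ if there is no such path). For $a\in C\setminus\{p\}$ (or more generally any point $a$ with $d(a,p)\ge R$), $\pi_p(a)\subseteq S_p$ is the set of nearest-point projections of $a$ to $S_p$, equivalently the set of intersection points of geodesics $[p,a]$ with $S_p$. Write $d_p(a,b)=\operatorname{diam}_{S_p}(\pi_p(a)\cup\pi_p(b))$. Projection axioms with constant $\theta$ for a collection $\mathcal{Y}$ of metric spaces with maps $\pi_Y:\mathcal{Y}\setminus\{Y\}\to 2^Y$, writing $d_Y(X,Z)=\operatorname{diam}(\pi_Y(X)\cup\pi_Y(Z))$: (P1) $\operatorname{diam}\pi_Y(X)\le\theta$ for $X\ne Y$; (P2) if $d_Y(X,Z)>\theta$ then $d_X(Y,Z)\le\theta$; (P3) for any $X,Z$ the set $\{Y\ne X,Z: d_Y(X,Z)>\theta\}$ is finite. Strong projection axioms: (P1), (P3), and (P2+) if $d_X(Y,Z)>\theta$ then $d_Y(Z,W)=d_Y(X,W)$ for all distinct $X,Y,Z,W$. By a theorem of Bestvina–Bromberg–Fujiwara–Sisto (used here as a black box), data satisfying the projection axioms with constant $\theta_0$ can be replaced by projections $\pi'_Y$ satisfying the strong projection axioms with constant $11\theta_0$ and with $d_Y-2\theta_0\le d'_Y\le d_Y+2\theta_0$; this is the ''upgrade''. The projection complex $\mathcal{P}(\mathcal{Y},\theta,K)$ (with $K\ge 3\theta$) is the graph with vertex set $\mathcal{Y}$,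 in which $X\ne Z$ are adjacent iff $d_Y(X,Z)\le K$ for every $Y\in\mathcal{Y}\setminus\{X,Z\}$; vertices $S_p$ are identified with $p\in C$. For a group $G$ acting on a projection complex $\mathcal{P}$, a family $\{G_c\}_{c\in V\mathcal{P}}$ with $G_c$ contained in the stabilizer of $c$ is an $L$-spinning family if $gG_cg^{-1}=G_{gc}$ for all $g\in G$, and $d_a(b,gb)\ge L$ for all distinct vertices $a,b$ and all $g\in G_a\setminus\{1\}$. *)

(* Defs.v *)
From HB Require Import structures.
From mathcomp Require Import all_boot all_order all_algebra.
From mathcomp Require Import all_classical all_reals.
From mathcomp Require Import ereal topology normedtype sequences exp.

Set Implicit Arguments.
Unset Strict Implicit.
Unset Printing Implicit Defensive.

Import Order.TTheory GRing.Theory Num.Theory.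
Local Open Scope classical_set_scope.
Local Open Scope ring_scope.

Section Geometry.
Context {R : realType} {X : Type} (d : X -> X -> R).

Definition is_metric : Prop :=
  (forall x y, d x y = 0 <-> x = y) /\
  (forall x y, d x y = d y x) /\
  (forall x y z, d x z <= d x y + d y z).

Definition geodesic (x y : X) (g : R -> X) : Prop :=
  g 0 = x /\ g (d x y) = y /\
  forall s t, 0 <= s <= d x y -> 0 <= t <= d x y -> d (g s) (g t) = `|s - t|.

Definition geodesic_space : Prop := forall x y, exists g, geodesic x y g.

(** Gromov product (y|z)_w : the length of the leg at w of the comparison tripod. *)
Definition gromov (w y z : X) : R := (d w y + d w z - d y z) / 2.

(** The geodesic triangle with sides g1 = [x,y], g2 = [y,z], g3 = [z,x] is
    delta-thin: points with the same image in the comparison tripod are at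
    distance <= delta.  (Points identified by chi are exactly the points on
    the two sides issuing from a vertex v at the same distance t <= (.|.)_v
    from v.) *)
Definition thin_triangle (delta : R) (x y z : X) (g1 g2 g3 : R -> X) : Prop :=
  (forall t, 0 <= t <= gromov x y z -> d (g1 t) (g3 (d z x - t)) <= delta) /\
  (forall t, 0 <= t <= gromov y z x -> d (g2 t) (g1 (d x y - t)) <= delta) /\
  (forall t, 0 <= t <= gromov z x y -> d (g3 t) (g2 (d y z - t)) <= delta).

Definition hyperbolic (delta : R) : Prop :=
  forall x y z g1 g2 g3, geodesic x y g1 -> geodesic y z g2 -> geodesic z x g3 ->
    thin_triangle delta x y z g1 g2 g3.

Definition cont_path (g : R -> X) : Prop :=
  forall s, 0 <= s <= 1 -> forall e, 0 < e ->
    exists2 r, 0 < r & forall t, 0 <= t <= 1 -> `|s - t| < r -> d (g s) (g t) < e.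

Definition poly_sum (g : R -> X) (s : seq R) : R :=
  \sum_(i < (size s).-1) d (g (nth 0 s i)) (g (nth 0 s i.+1)).

Definition path_length (g : R -> X) : \bar R :=
  ereal_sup [set (poly_sum g s)%:E | s in
    [set s : seq R | sorted <=%R s /\ all (fun t => (0 <= t <= 1)) s]].

Definition sphere (r : R) (p : X) : set X := [set x | d x p = r].

(** Induced path metric d_{S_p}: infimum of lengths of paths in X \ B_r(p)
    (= +oo if there is none). *)
Definition dS (r : R) (p : X) (x y : X) : \bar R :=
  ereal_inf [set path_length g | g in
    [set g : R -> X | cont_path g /\ g 0 = x /\ g 1 = y /\
                      forall t, 0 <= t <= 1 -> r <= d p (g t)]].

Definition diamS (r : R) (p : X) (A : set X) : \bar R :=
  ereal_sup [set dS r p x y | x in A & y in A].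

(** pi_p(a): intersection points of geodesics [p,a] with S_p. *)
Definition sproj (r : R) (p a : X) : set X :=
  [set x | exists g, geodesic p a g /\ g r = x].

Definition dproj (r : R) (pi : X -> X -> set X) (p a b : X) : \bar R :=
  diamS r p (pi p a `|` pi p b).

(** Projection axioms (P1),(P2),(P3) with constant theta, for the family
    indexed by C (vertex S_p identified with p). *)
Definition projection_axioms (r : R) (C : set X) (pi : X -> X -> set X) (theta : R) : Prop :=
  (forall p a, C p -> C a -> a <> p -> (diamS r p (pi p a) <= theta%:E)%E) /\
  (forall x y z, C x -> C y -> C z -> x <> y -> y <> z -> x <> z ->
     (theta%:E < dproj r pi y x z)%E -> (dproj r pi x y z <= theta%:E)%E) /\
  (forall x z, C x -> C z ->
     finite_set [set y | C y /\ y <> x /\ y <> z /\ (theta%:E < dproj r pi y x z)%E]).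

Definition strong_projection_axioms (r : R) (C : set X) (pi : X -> X -> set X) (theta : R) : Prop :=
  (forall p a, C p -> C a -> a <> p -> (diamS r p (pi p a) <= theta%:E)%E) /\
  (forall x y z w, C x -> C y -> C z -> C w ->
     x <> y -> x <> z -> x <> w -> y <> z -> y <> w -> z <> w ->
     (theta%:E < dproj r pi x y z)%E -> dproj r pi y z w = dproj r pi y x w) /\
  (forall x z, C x -> C z ->
     finite_set [set y | C y /\ y <> x /\ y <> z /\ (theta%:E < dproj r pi y x z)%E]).

Definition pc_adj (r : R) (C : set X) (pi : X -> X -> set X) (K : R) (p q : X) : Prop :=
  C p /\ C q /\ p <> q /\
  forall y, C y -> y <> p -> y <> q -> (dproj r pi y p q <= K%:E)%E.

Fixpoint pc_within (r : R) (C : set X) (pi : X -> X -> set X) (K : R) (n : nat)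
    (p q : X) : Prop :=
  match n with
  | 0 => C p /\ p = q
  | n'.+1 => (C p /\ p = q) \/
             exists y, pc_adj r C pi K p y /\ pc_within r C pi K n' y q
  end.

End Geometry.

Section Groups.
Context {G : Type} (mul : G -> G -> G) (one : G) (inv : G -> G).

Definition is_group : Prop :=
  (forall a b c, mul a (mul b c) = mul (mul a b) c) /\
  (forall a, mul one a = a) /\ (forall a, mul (inv a) a = one).

Definition subgroup (H : set G) : Prop :=
  H one /\ (forall a b, H a -> H b -> H (mul a b)) /\ (forall a, H a -> H (inv a)).

Context {R : realType} {X : Type} (d : X -> X -> R) (act : G -> X -> X).

Definition isometric_action : Prop :=
  (forall x, act one x = x) /\ (forall g h x, act (mul g h) x = act g (act h x)) /\
  (forall g x y, d (act g x) (act g y) = d x y).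

Definition rotating_family (C : set X) (Gc : X -> set G) : Prop :=
  (forall g c, C c -> C (act g c)) /\
  (forall c, C c -> subgroup (Gc c)) /\
  (forall c g, C c -> Gc c g -> act g c = c) /\
  (forall g c, C c -> Gc (act g c) = [set mul (mul g h) (inv g) | h in Gc c]).

Definition rho_separated (rho : R) (C : set X) : Prop :=
  forall c c', C c -> C c' -> c <> c' -> rho <= d c c'.

Definition fairly_rotating (C : set X) (Gc : X -> set G) : Prop :=
  forall c g x, C c -> Gc c g -> g <> one -> C x -> x <> c ->
    exists gam, geodesic d x (act g x) gam /\
      exists2 t, 0 <= t <= d x (act g x) & d (gam t) c <= 1.

End Groups.

(* Main.v *)
(** If (a|b)_p >= r + delta, then geodesics [p,a] and [p,b] can be joined just
    outside the ball, so d_p(a,b) <= 3 delta.  Since (x|z)_y + (y|z)_x = d(x,y)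
    and apices are 2r + 6 delta apart, the projection axioms hold with constant
    3 delta.

    To upgrade, fix p and join two apices whenever one lies in the shadow of the
    other as seen from p, i.e. (p|v)_u < r + delta; the new projection of a is
    the union of the projections of all apices in its connected component.  In
    a finite zigzag of shadows all members lie in the slightly larger shadow of
    the member nearest to p, so components have projections of diameter at most
    3 delta, and the new projection is constant along shadows, which is (P2+).

    For spinning, a path of length l outside the r-ball about c, extended by
    4 delta, joins two points of a geodesic passing within 1 of c.  Halving
    the path n times moves a point of that geodesic to within
    n delta + l / 2^(n+1) of the path, hence l is exponentially large in r. *)

Require Import Defs.
From HB Require Import structures.
From mathcomp Require Import all_boot all_order all_algebra.
From mathcomp Require Import all_classical all_reals.
From mathcomp Require Import ereal topology normedtype sequences exp.
From mathcomp Require Import zify ring lra.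
Import Order.TTheory GRing.Theory Num.Theory.
Local Open Scope classical_set_scope.
Local Open Scope ring_scope.

Set Implicit Arguments.
Unset Strict Implicit.
Unset Printing Implicit Defensive.

(** * Lengths of paths, concatenation and the induced path metric *)

Section PathLength.
Context {R : realType} {X : Type} (d : X -> X -> R).
Context (metric_d : is_metric d).

Lemma dist_refl x : d x x = 0.
Proof. by case: metric_d => /(_ x x) [_ ->]. Qed.

Lemma dist_sym x y : d x y = d y x.
Proof. by case: metric_d => _ []. Qed.

Lemma dist_triangle y x z : d x z <= d x y + d y z.
Proof. by case: metric_d => _ []. Qed.

Lemma dist_ge0 x y : 0 <= d x y.
Proof.
have := dist_triangle y x x; rewrite dist_refl (dist_sym y x); lra.
Qed.

Definition partition01 (s : seq R) : Prop :=
  sorted <=%R s /\ all (fun t => 0 <= t <= 1) s.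

Lemma poly_sum_nil (g : R -> X) : poly_sum d g [::] = 0.
Proof. by rewrite /poly_sum big_ord0. Qed.

Lemma poly_sum1 (g : R -> X) a : poly_sum d g [:: a] = 0.
Proof. by rewrite /poly_sum big_ord0. Qed.

Lemma poly_sum_cons (g : R -> X) a b s :
  poly_sum d g (a :: b :: s) = d (g a) (g b) + poly_sum d g (b :: s).
Proof. by rewrite /poly_sum /= big_ord_recl. Qed.

Lemma poly_sum_ge0 (g : R -> X) s : 0 <= poly_sum d g s.
Proof. by apply: sumr_ge0 => i _; apply: dist_ge0. Qed.

Lemma poly_sum_le_cons (g : R -> X) a s :
  poly_sum d g s <= poly_sum d g (a :: s).
Proof.
case: s => [|b s]; first by rewrite poly_sum_nil poly_sum1.
by rewrite poly_sum_cons lerDr dist_ge0.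
Qed.

Lemma poly_sum_le_length (g : R -> X) s :
  partition01 s -> ((poly_sum d g s)%:E <= path_length d g)%E.
Proof. by move=> ps; apply: ereal_sup_ubound; exists s. Qed.

Lemma path_length_le (g : R -> X) (M : \bar R) :
  (forall s, partition01 s -> ((poly_sum d g s)%:E <= M)%E) ->
  (path_length d g <= M)%E.
Proof. by move=> H; apply: ge_ereal_sup => _ [s ps <-]; apply: H. Qed.

Lemma path_length_ge0 (g : R -> X) : (0 <= path_length d g)%E.
Proof.
by have := @poly_sum_le_length g [::]; rewrite poly_sum_nil; apply.
Qed.

Definition lipschitz01 (L : R) (g : R -> X) : Prop :=
  forall s t, 0 <= s <= 1 -> 0 <= t <= 1 -> d (g s) (g t) <= L * `|s - t|.

Lemma lipschitz_cont_path L g : 0 <= L -> lipschitz01 L g -> cont_path d g.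
Proof.
move=> L0 lg s s01 e e0; exists (e / (L + 1)).
  by apply: divr_gt0 => //; lra.
move=> t t01 st; apply: le_lt_trans (lg _ _ s01 t01) _.
have st' : `|s - t| * (L + 1) < e by rewrite -ltr_pdivlMr//; lra.
have := normr_ge0 (s - t); nra.
Qed.

(** The factor [1 - a] is the time left after the first partition point; in this form the induction
    telescopes. *)
Lemma lipschitz_poly_sum L g a s : 0 <= L -> lipschitz01 L g ->
  partition01 (a :: s) -> poly_sum d g (a :: s) <= L * (1 - a).
Proof.
move=> L0 lg; elim: s a => [|b s IH] a [/= ss /andP[a01 sa]].
  by rewrite poly_sum1; nra.
move: ss sa => /andP[ab ss] /andP[b01 sb].
rewrite poly_sum_cons.
have H1 := IH b (conj ss (introT andP (conj b01 sb))).
have := lg _ _ a01 b01; rewrite ler0_norm ?subr_le0//; nra.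
Qed.

Lemma lipschitz_path_length L g : 0 <= L -> lipschitz01 L g ->
  (path_length d g <= L%:E)%E.
Proof.
move=> L0 lg; apply: path_length_le => -[|a s] ps.
  by rewrite poly_sum_nil lee_fin.
rewrite lee_fin (le_trans (lipschitz_poly_sum L0 lg ps))//.
case: ps => _ /= /andP[a01 _]; nra.
Qed.

Definition concat_path (g h : R -> X) (t : R) : X :=
  if t <= 2^-1 then g (2 * t) else h (2 * t - 1).

Lemma concat_path0 g h : concat_path g h 0 = g 0.
Proof. by rewrite /concat_path ifT ?mulr0//; lra. Qed.

Lemma concat_path1 g h : concat_path g h 1 = h 1.
Proof. by rewrite /concat_path ifF; [congr h; lra|apply/negP; lra]. Qed.

Lemma concat_path_cont g h : g 1 = h 0 ->
  cont_path d g -> cont_path d h -> cont_path d (concat_path g h).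
Proof.
move=> gh cg ch s s01 e e0.
rewrite /concat_path; case: (ltrgtP s 2^-1) => hs.
- have [r r0 Hr] := cg (2 * s) ltac:(lra) e e0.
  exists (Num.min (r / 2) (2^-1 - s)); first by rewrite lt_min; apply/andP; lra.
  move=> t t01; rewrite lt_min => /andP[st1 st2].
  have {}st2 : t <= 2^-1 by move: st2; rewrite ltr_distlC; lra.
  rewrite st2; apply: Hr; first lra.
  by rewrite -mulrBr normrM ger0_norm//; lra.
- have [r r0 Hr] := ch (2 * s - 1) ltac:(lra) e e0.
  exists (Num.min (r / 2) (s - 2^-1)); first by rewrite lt_min; apply/andP; lra.
  move=> t t01; rewrite lt_min => /andP[st1 st2].
  have {}st2 : 2^-1 < t by move: st2; rewrite ltr_distl; lra.
  rewrite leNgt st2/=; apply: Hr; first lra.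
  have -> : 2 * s - 1 - (2 * t - 1) = 2 * (s - t) by ring.
  by rewrite normrM ger0_norm//; lra.
- have [r1 r10 Hr1] := cg 1 ltac:(lra) e e0.
  have [r2 r20 Hr2] := ch 0 ltac:(lra) e e0.
  exists (Num.min (r1 / 2) (r2 / 2)); first by rewrite lt_min; apply/andP; lra.
  move=> t t01; rewrite lt_min => /andP[st1 st2].
  have -> : 2 * s = 1 by rewrite hs; lra.
  case: ifPn => ht.
    apply: Hr1; first lra.
    have -> : 1 - 2 * t = 2 * (s - t) by rewrite hs; field.
    by rewrite normrM ger0_norm//; lra.
  rewrite gh; apply: Hr2; first lra.
  have -> : 0 - (2 * t - 1) = 2 * (s - t) by rewrite hs; field.
  by rewrite normrM ger0_norm//; lra.
Qed.

(** The junction time is adjoined, as last point 1 here and as first point 0 in [second_half], so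
    that a step straddling 1/2 can be broken at [g 1 = h 0] by the triangle inequality. *)
Definition first_half (s : seq R) : seq R :=
  rcons [seq 2 * t | t <- s & t <= 2^-1] 1.

Definition second_half (s : seq R) : seq R :=
  0 :: [seq 2 * t - 1 | t <- s & ~~ (t <= 2^-1)].

Lemma first_half_partition s : partition01 s -> partition01 (first_half s).
Proof.
case=> ss /allP s01; split.
  rewrite le_sorted_pairwise pairwise_rcons; apply/andP; split.
    by apply/allP => _ /mapP[t + ->]; rewrite mem_filter => /andP[? _]; lra.
  rewrite pairwise_map; apply: pairwise_filter.
  by move: ss; rewrite le_sorted_pairwise; apply: sub_pairwise => a b /=; lra.
rewrite all_rcons; apply/andP; split; first lra.
apply/allP => _ /mapP[t + ->]; rewrite mem_filter => /andP[? /s01]; lra.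
Qed.

Lemma second_half_partition s : partition01 s -> partition01 (second_half s).
Proof.
case=> ss /allP s01; split.
  rewrite le_sorted_pairwise /=; apply/andP; split.
    by apply/allP => _ /mapP[t + ->]; rewrite mem_filter => /andP[? _]; lra.
  rewrite pairwise_map; apply: pairwise_filter.
  by move: ss; rewrite le_sorted_pairwise; apply: sub_pairwise => a b /=; lra.
apply/andP; split; first lra.
apply/allP => _ /mapP[t + ->]; rewrite mem_filter => /andP[? /s01]; lra.
Qed.

Lemma first_half_nil s : all (fun t => ~~ (t <= 2^-1)) s -> first_half s = [:: 1].
Proof.
rewrite /first_half => /allP H; rewrite (_ : [seq t <- s | _] = [::])//.
by apply/eqP; rewrite -(negbK (_ == _)) -has_filter; apply/hasPn.
Qed.

Lemma concat_poly_sum_second g h s : all (fun t => ~~ (t <= 2^-1)) s ->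
  poly_sum d (concat_path g h) s = poly_sum d h [seq 2 * t - 1 | t <- s].
Proof.
elim: s => [|a [|b s] IH]; rewrite ?poly_sum_nil ?poly_sum1//=.
move=> /andP[a2 Hs]; have := IH Hs; rewrite /= !poly_sum_cons => ->.
by move: Hs => /= /andP[b2 _]; rewrite /concat_path (negPf a2) (negPf b2).
Qed.

Lemma concat_poly_sum_le g h s : g 1 = h 0 -> partition01 s ->
  poly_sum d (concat_path g h) s <=
    poly_sum d g (first_half s) + poly_sum d h (second_half s).
Proof.
move=> gh; elim: s => [|a s IH] [ss s01].
  by rewrite poly_sum_nil addr_ge0 ?poly_sum_ge0.
have [a2|a2] := boolP (a <= 2^-1); last first.
  have Hs : all (fun t => ~~ (t <= 2^-1)) (a :: s).
    move: ss; rewrite le_sorted_pairwise/= a2 => /andP[/allP H _].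
    by apply/allP => t /H; lra.
  rewrite concat_poly_sum_second// /second_half.
  move/all_filterP: Hs => ->.
  by rewrite ler_wpDl ?poly_sum_ge0// poly_sum_le_cons.
have {IH} := IH (conj (path_sorted ss) (proj2 (andP s01))).
case: s ss s01 => [|b s] ss s01.
  by move=> _; rewrite poly_sum1 addr_ge0 ?poly_sum_ge0.
rewrite poly_sum_cons => IH.
have [b2|b2] := boolP (b <= 2^-1).
  move: IH; rewrite /first_half /second_half /= a2 b2 /= poly_sum_cons.
  by rewrite {2}/concat_path a2 /concat_path b2 => ?; rewrite -addrA lerD2l.
have Hs : all (fun t => ~~ (t <= 2^-1)) (b :: s).
  move: ss; rewrite le_sorted_pairwise/= => /andP[_ /andP[/allP H _]].
  rewrite b2; apply/allP => t /H; move: b2; rewrite -!ltNge; exact: lt_le_trans.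
have -> : first_half [:: a, b & s] = [:: 2 * a; 1].
  by rewrite -(first_half_nil Hs) /first_half /= a2.
have -> : second_half [:: a, b & s] = 0 :: [seq 2 * t - 1 | t <- b :: s].
  by rewrite /second_half /= a2/=; move/all_filterP: Hs => /= ->.
rewrite concat_poly_sum_second//= !poly_sum_cons poly_sum1 addr0 addrA lerD2r.
by rewrite /concat_path a2 (negPf b2) gh; apply: dist_triangle.
Qed.

Lemma concat_path_length g h : g 1 = h 0 ->
  (path_length d (concat_path g h) <= path_length d g + path_length d h)%E.
Proof.
move=> gh; apply: path_length_le => s ps.
apply: (@le_trans _ _ (poly_sum d g (first_half s) + poly_sum d h (second_half s))%:E).
  by rewrite lee_fin concat_poly_sum_le.
rewrite EFinD; apply: leeD; apply: poly_sum_le_length.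
  exact: first_half_partition.
exact: second_half_partition.
Qed.

Definition outside_path (r : R) (p x y : X) (g : R -> X) : Prop :=
  cont_path d g /\ g 0 = x /\ g 1 = y /\
  forall t, 0 <= t <= 1 -> r <= d p (g t).

Lemma dS_le_length r p x y g :
  outside_path r p x y g -> (dS d r p x y <= path_length d g)%E.
Proof. by move=> og; apply: ge_ereal_inf; exists (path_length d g) => //; exists g. Qed.

Lemma dS_ge0 r p x y : (0 <= dS d r p x y)%E.
Proof. by apply/ereal_infP => _ [g _ <-]; apply: path_length_ge0. Qed.

Lemma dS_lipschitz r p (L : R) (g : R -> X) : 0 <= L -> lipschitz01 L g ->
  (forall t, 0 <= t <= 1 -> r <= d p (g t)) ->
  (dS d r p (g 0%R) (g 1%R) <= L%:E)%E.
Proof.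
move=> L0 lg og; apply: le_trans (lipschitz_path_length L0 lg).
by apply: dS_le_length; split; first exact: lipschitz_cont_path lg.
Qed.

Lemma dS_triangle r p y x z :
  (dS d r p x z <= dS d r p x y + dS d r p y z)%E.
Proof.
have [/eqP xy|xy] := eqVneq (dS d r p x y) +oo%E.
  by rewrite (eqP xy) addye ?leey// gt_eqF// (lt_le_trans _ (dS_ge0 _ _ _ _))// ltNy0.
have [/eqP yz|yz] := eqVneq (dS d r p y z) +oo%E.
  by rewrite (eqP yz) addey ?leey// gt_eqF// (lt_le_trans _ (dS_ge0 _ _ _ _))// ltNy0.
have fxy : dS d r p x y \is a fin_num by rewrite ge0_fin_numE ?dS_ge0// ltey.
have fyz : dS d r p y z \is a fin_num by rewrite ge0_fin_numE ?dS_ge0// ltey.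
(* Both infima are finite from here on; paths within [e / 2] of each are concatenated. *)
apply/lee_addgt0Pr => e e0.
have e2 : 0 < e / 2 by lra.
have [_ [g [cg [g0 [g1 og]]] <-] lg] := lb_ereal_inf_adherent e2 fxy.
have [_ [h [ch [h0 [h1 oh]]] <-] lh] := lb_ereal_inf_adherent e2 fyz.
have gh : g 1 = h 0 by rewrite g1 h0.
apply: (@le_trans _ _ (path_length d (concat_path g h))).
  apply: dS_le_length; split; first exact: concat_path_cont.
  rewrite concat_path0 concat_path1; split=> //; split=> // t t01.
  by rewrite /concat_path; case: ifPn => ?; [apply: og|apply: oh]; lra.
apply: le_trans (concat_path_length gh) _.
have -> : (e = e / 2 + e / 2)%R by lra.
by rewrite EFinD addeACA; apply: leeD; apply: ltW.
Qed.

Lemma dS_le_diam r p (A : set X) x y : A x -> A y ->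
  (dS d r p x y <= diamS d r p A)%E.
Proof. by move=> Ax Ay; apply: ereal_sup_ubound; exists x => //; exists y. Qed.

Lemma diamS_le r p (A : set X) (M : \bar R) :
  (forall x y, A x -> A y -> (dS d r p x y <= M)%E) -> (diamS d r p A <= M)%E.
Proof. by move=> H; apply: ge_ereal_sup => _ [x Ax [y Ay <-]]; apply: H. Qed.

Lemma diamS_subset r p (A B : set X) : A `<=` B ->
  (diamS d r p A <= diamS d r p B)%E.
Proof. by move=> AB; apply: diamS_le => x y /AB Bx /AB By; apply: dS_le_diam. Qed.

(* Instead of compactness of [0,1]: the supremum of the times reachable from 0
   by a partition with steps at most [e] is 1 and is itself reachable. *)
Lemma fine_partition (g : R -> X) (e : R) : cont_path d g -> 0 < e ->
  exists s : seq R, partition01 (0 :: s) /\ last 0 s = 1 /\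
    path (fun a b => d (g a) (g b) <= e) 0 s.
Proof.
move=> cg e0.
pose S := [set t : R | 0 <= t <= 1 /\ exists s : seq R,
  partition01 (0 :: s) /\ last 0 s = t /\ path (fun a b => d (g a) (g b) <= e) 0 s].
have S0 : S 0.
  split; first lra; exists [::]; split=> //; split => //=; rewrite andbT; lra.
have extend t u : S t -> t <= u <= 1 -> d (g t) (g u) <= e -> S u.
  move=> [t01 [s [[ss /= sa] [st ps]]]] tu dtu; split; first lra.
  exists (rcons s u); split; last first.
    by rewrite last_rcons rcons_path ps st.
  split; first by rewrite /= rcons_path; move: ss => /= ->; rewrite st /=; lra.
  by rewrite /= all_rcons; apply/and3P; split; [lra|lra|case/andP: sa].
have supS : has_sup S.
  by split; [exists 0|exists 1 => t [? _]; lra].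
have m01 : 0 <= sup S <= 1.
  apply/andP; split; first exact: ub_le_sup supS.2 _ S0.
  by apply: ge_sup => [|t [? _]]; [exists 0|lra].
have [q q0 Hq] := cg _ m01 e e0.
have [t St tm] := sup_adherent q0 supS.
have tm' : t <= sup S by apply: ub_le_sup supS.2 _ St.
have t01 : 0 <= t <= 1 by case: St.
have Sm : S (sup S).
  apply: (extend t) => //; first lra.
  by rewrite dist_sym; apply/ltW/Hq => //; rewrite ger0_norm; lra.
have [m1|m1] := eqVneq (sup S) 1; first by case: Sm => _; rewrite m1.
have mlt : sup S < 1 by rewrite lt_neqAle m1; lra.
pose u := Num.min 1 (sup S + q / 2).
have u1 : u <= 1 by rewrite ge_min lexx.
have uq : u <= sup S + q / 2 by rewrite ge_min lexx orbT.
have mu : sup S < u by rewrite lt_min; apply/andP; split; lra.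
have Su : S u.
  apply: (extend (sup S)) => //; first lra.
  by apply/ltW/Hq; [lra|rewrite ltr0_norm; lra].
have := ub_le_sup supS.2 Su; lra.
Qed.

End PathLength.

Lemma all_last (T : Type) (P : pred T) x s : all P (x :: s) -> P (last x s).
Proof.
elim: s x => [|y s IH] x /=; first by rewrite andbT.
by move=> /andP[_]; apply: IH.
Qed.

(** * Gromov products and thin triangles *)

Section Hyperbolic.
Context {R : realType} {X : Type} (d : X -> X -> R) (delta : R).
Context (metric_d : is_metric d) (geod_d : geodesic_space d).
Context (delta_gt0 : 0 < delta) (hyp_d : hyperbolic d delta).

Local Notation dsym := (dist_sym metric_d).
Local Notation dge0 := (dist_ge0 metric_d).
Local Notation dtri := (dist_triangle metric_d).

Lemma gromov_sym w y z : gromov d w y z = gromov d w z y.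
Proof. by rewrite /gromov (dsym z y); lra. Qed.

Lemma gromov_diag w y : gromov d w y y = d w y.
Proof. by rewrite /gromov (dist_refl metric_d); lra. Qed.

Lemma gromov_base w y : gromov d w y w = 0.
Proof. by rewrite /gromov (dist_refl metric_d) (dsym y w); lra. Qed.

(** The legs at [x] and [y] of the comparison tripod fill the side between them. This identity
    trades a small product at one apex for a large one at another. *)
Lemma gromov_compl x y z : gromov d x y z = d x y - gromov d y x z.
Proof. by rewrite /gromov (dsym y x); lra. Qed.

Lemma gromov_ge0 w y z : 0 <= gromov d w y z.
Proof. by have := dtri w y z; rewrite /gromov (dsym y w); lra. Qed.

Lemma gromov_lel w y z : gromov d w y z <= d w y.
Proof. by have := gromov_ge0 y w z; rewrite (gromov_compl w y z); lra. Qed.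

Lemma gromov_ler w y z : gromov d w y z <= d w z.
Proof. by rewrite gromov_sym; apply: gromov_lel. Qed.

Lemma geodesic_rev x y g :
  geodesic d x y g -> geodesic d y x (fun t => g (d x y - t)).
Proof.
move=> [g0 [g1 gi]]; rewrite /geodesic (dsym y x) subr0 subrr; split=> //; split=> //.
move=> s t ? ?; rewrite gi; [|lra|lra].
by rewrite distrC; congr `| _ |; ring.
Qed.

Lemma geodesic_dist_left x y g t :
  geodesic d x y g -> 0 <= t <= d x y -> d x (g t) = t.
Proof.
move=> [g0 [g1 gi]] t01; rewrite -[in d x _]g0 gi//; last by have := dge0 x y; lra.
by rewrite sub0r normrN ger0_norm; lra.
Qed.

Lemma geodesic_dist_right x y g t :
  geodesic d x y g -> 0 <= t <= d x y -> d (g t) y = d x y - t.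
Proof.
move=> [g0 [g1 gi]] t01; rewrite -[in d _ y]g1 gi//; last by have := dge0 x y; lra.
by rewrite ler0_norm; lra.
Qed.

Lemma thin_at p a b g h t : geodesic d p a g -> geodesic d p b h ->
  0 <= t <= gromov d p a b -> d (g t) (h t) <= delta.
Proof.
move=> gg gh t01; have [k gk] := geod_d a b.
have [+ _] := hyp_d gg gk (geodesic_rev gh).
by move=> /(_ t t01); rewrite (dsym b p) (_ : _ - (_ - t) = t)//; ring.
Qed.

(** The points at distance [m] from [p] on the three geodesics are successively within [delta],
    which bounds [d x z] by [d p x + d p z - 2 * m + 2 * delta]; halving leaves a loss of
    [delta]. *)
Lemma four_point y p x z :
  Num.min (gromov d p x y) (gromov d p y z) - delta <= gromov d p x z.
Proof.
have [gx Hx] := geod_d p x; have [gy Hy] := geod_d p y; have [gz Hz] := geod_d p z.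
set m := Num.min _ _.
have m0 : 0 <= m by rewrite le_min !gromov_ge0.
have m1 : m <= gromov d p x y by rewrite ge_min lexx.
have m2 : m <= gromov d p y z by rewrite ge_min lexx orbT.
have mx : m <= d p x := le_trans m1 (gromov_lel _ _ _).
have mz : m <= d p z := le_trans m2 (gromov_ler _ _ _).
have H1 := thin_at Hx Hy (introT andP (conj m0 m1)).
have H2 := thin_at Hy Hz (introT andP (conj m0 m2)).
have H3 := geodesic_dist_right Hx (introT andP (conj m0 mx)).
have H4 := geodesic_dist_right Hz (introT andP (conj m0 mz)).
have T1 := dtri (gx m) x z; have T2 := dtri (gy m) (gx m) z.
have T3 := dtri (gz m) (gy m) z; rewrite (dsym x (gx m)) in T1.
by rewrite /gromov; lra.
Qed.

Lemma gromov_lt_of_close p x y z c :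
  c + delta <= gromov d p y z -> gromov d p x z < c ->
  gromov d p x y < c + delta.
Proof.
move=> yz xz; rewrite ltNge; apply/negP => xy.
have := lt_le_trans xz (_ : c <= Num.min (gromov d p x y) (gromov d p y z) - delta).
by rewrite ltNge four_point lerBrDr le_min xy yz => /(_ isT).
Qed.

Definition on_segment (x y p : X) : Prop :=
  exists g t, geodesic d x y g /\ 0 <= t <= d x y /\ g t = p.

Lemma on_segment_sym x y p : on_segment x y p -> on_segment y x p.
Proof.
move=> [g [t [gg [t01 <-]]]]; exists (fun t => g (d x y - t)), (d x y - t).
split; first exact: geodesic_rev.
rewrite (dsym y x); split; [lra|congr g; ring].
Qed.

Lemma on_segment_dist x y p : on_segment x y p -> d x p + d p y = d x y.
Proof.
move=> [g [t [gg [t01 <-]]]].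
by rewrite (geodesic_dist_left gg t01) (geodesic_dist_right gg t01); ring.
Qed.

Lemma on_subsegment x y g s t u : geodesic d x y g ->
  0 <= s -> s <= t -> t <= u -> u <= d x y -> on_segment (g s) (g u) (g t).
Proof.
move=> [g0 [g1 gi]] s0 st tu ud.
have D : d (g s) (g u) = u - s by rewrite gi ?ler0_norm; lra.
exists (fun v => g (s + v)), (t - s); split; last by rewrite D; split; [lra|congr g; ring].
rewrite /geodesic D addr0; split=> //; split; first by congr g; ring.
move=> v w ? ?; rewrite gi; [|lra|lra].
by congr `| _ |; ring.
Qed.

Lemma slim z x y p : on_segment x y p ->
  exists q, (on_segment x z q \/ on_segment z y q) /\ d p q <= delta.
Proof.
move=> [g [t [gg [t01 <-]]]].
have [gz Hz] := geod_d x z; have [gy Hy] := geod_d y z.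
(* The point of the side at distance (y|z)_x from [x] maps to the centre of the tripod; before it
   thinness at [x] applies, after it thinness at [y]. *)
have [tg|tg] := lerP t (gromov d x y z).
  exists (gz t); split; last by apply: thin_at gg Hz _; lra.
  left; exists gz, t; split=> //; split=> //.
  by have := gromov_ler x y z; lra.
have T : 0 <= d x y - t <= gromov d y x z by move: tg; rewrite gromov_compl; lra.
exists (gy (d x y - t)); split; last first.
  have := thin_at (geodesic_rev gg) Hy T.
  by rewrite (_ : d x y - (d x y - t) = t)//; ring.
right; apply: on_segment_sym; exists gy, (d x y - t); split=> //; split=> //.
by have := gromov_ler y x z; lra.
Qed.

(** * Exponential lower bound by halving chains *)

Fixpoint chain_length (x : X) (s : seq X) : R :=
  if s is y :: s' then d x y + chain_length y s' else 0.

Lemma chain_length_ge0 x s : 0 <= chain_length x s.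
Proof. by elim: s x => //= y s IH x; rewrite addr_ge0 ?dge0. Qed.

Lemma dist_le_chain_length x s : d x (last x s) <= chain_length x s.
Proof.
elim: s x => [|y s IH] x /=; first by rewrite (dist_refl metric_d).
by apply: le_trans (dtri y _ _) _; rewrite lerD2l.
Qed.

(** The cut is at the first chain point after [x] where the accumulated length reaches [b], so it
    overshoots by at most one step. *)
Lemma chain_split e b x s : 0 <= e -> 0 <= b <= chain_length x s ->
  path (fun u v => d u v <= e) x s ->
  exists s1 s2, s = s1 ++ s2 /\ chain_length x s1 <= b + e /\
    chain_length (last x s1) s2 <= chain_length x s - b.
Proof.
move=> e0; elim: s x b => [|y s IH] x b /= b0.
  by move=> _; exists [::], [::]; split=> //=; split; lra.
move=> /andP[xy ps]; have [bxy|bxy] := lerP b (d x y).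
  by exists [:: y], s; split=> //=; split; lra.
have [|s1 [s2 [-> [H1 H2]]]] := IH y (b - d x y) _ ps; first lra.
by exists (y :: s1), s2; split=> //=; move: H2; rewrite /=; split; lra.
Qed.

(* Halving the chain costs [delta] by slimness, and the mesh [e] accounts for
   the chain point nearest to the midpoint. *)
Lemma chain_dist_bound N e B T x s p : 0 <= e ->
  path (fun u v => d u v <= e) x s -> chain_length x s <= T ->
  all (fun q => B <= d p q) (x :: s) -> on_segment x (last x s) p ->
  B <= delta * N%:R + T / 2 * 2^-1 ^+ N + e * (1 - 2^-1 ^+ N).
Proof.
move=> e0; elim: N B T x s p => [|N IH] B T x s p ps sT Hs sp.
  (* Without halving: both endpoints are at distance at least [B] from [p], and these two distances
     add up to at most [T]. *)
  have H1 := on_segment_dist sp; have H2 := dist_le_chain_length x s.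
  have Bx : B <= d p x by case/andP: Hs.
  have Bl : B <= d p (last x s) := all_last Hs.
  by rewrite expr0 (dsym x p) in H1 *; lra.
have l0 := chain_length_ge0 x s.
have [|s1 [s2 [def_s [H1 H2]]]] := chain_split (b := chain_length x s / 2) e0 _ ps.
  by lra.
have [q [Hq pq]] := slim (last x s1) sp.
(* Either half has length at most [T / 2 + e]. Iterating this [N] times from [T] and halving the
   result gives the last two terms of the bound. *)
have key : B - delta <= delta * N%:R + (T / 2 + e) / 2 * 2^-1 ^+ N + e * (1 - 2^-1 ^+ N).
  have closer z : B <= d p z -> B - delta <= d q z.
    by have := dtri q p z; lra.
  move: ps Hs; rewrite def_s cat_path /= all_cat => /andP[p1 p2] /and3P[Hx Hs1 Hs2].
  case: Hq => Hq.
    apply: (IH _ _ x s1 q) => //; first lra.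
    by rewrite /= closer//=; apply: sub_all Hs1 => z; apply: closer.
  apply: (IH _ _ (last x s1) s2 q) => //; first lra.
    have Hl : all (fun q => B <= d p q) (x :: s1) by rewrite /= Hx.
    rewrite /= (closer _ (all_last Hl))/=.
    by apply: sub_all Hs2 => z; apply: closer.
  by move: Hq; rewrite def_s last_cat.
have -> : delta * N.+1%:R = delta * N%:R + delta by rewrite -natr1; ring.
rewrite exprS; move: key; set a := 2^-1 ^+ N => key.
have -> : delta * N%:R + delta + T / 2 * (2^-1 * a) + e * (1 - 2^-1 * a) =
    delta * N%:R + (T / 2 + e) / 2 * a + e * (1 - a) + delta by field.
by rewrite -lerBlDr.
Qed.

Lemma chain_length_map (g : R -> X) t s :
  chain_length (g t) (map g s) = poly_sum d g (t :: s).
Proof.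
elim: s t => [|u s IH] t /=; first by rewrite poly_sum1.
by rewrite poly_sum_cons IH.
Qed.

Lemma dS_exp_lower_bound (r : R) a u v c : 2 <= r -> on_segment u v c -> d a c <= 1 ->
  ((powR 2 ((r - 2) / delta))%:E <= dS d r a u v)%E.
Proof.
move=> r2 sc ac; apply/ereal_infP => _ [k [ck [k0 [k1 ok]]] <-].
set P := powR _ _.
have x0 : 0 <= (r - 2) / delta by apply: divr_ge0; [lra|exact: ltW].
pose N := Num.trunc ((r - 2) / delta).
have /andP[Nx xN] := truncn_itv x0; rewrite -/N in Nx xN.
have {}Nx : delta * N%:R <= r - 2 by rewrite mulrC -ler_pdivlMr.
have P0 : 0 < P by rewrite powR_gt0.
have PN : P < 2 ^+ N.+1.
  rewrite -powR_mulrn// /P /powR pnatr_eq0/= ltr_expR ltr_pM2r//.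
  by rewrite ln_gt0//; lra.
have Q0 : 0 < (2 : R) ^+ N.+1 by rewrite exprn_gt0.
(* The strict inequality [P < 2 ^+ N.+1] leaves room for a positive mesh, and this choice makes the
   final estimate return exactly [P], without a limit. *)
pose e := 1 - P / 2 ^+ N.+1.
have e0 : 0 < e by rewrite subr_gt0 ltr_pdivrMr// mul1r.
have [s [ps [s1 fs]]] := fine_partition metric_d ck e0.
apply: le_trans (poly_sum_le_length d k ps); rewrite lee_fin.
have : r - 1 <= delta * N%:R + poly_sum d k (0 :: s) / 2 * 2^-1 ^+ N + e * (1 - 2^-1 ^+ N).
  (* The path keeps distance at least [r] from [a], and [c] is within 1 of [a]; hence the lower
     bound [r - 1] on distances to [c]. *)
  apply: (@chain_dist_bound N e _ _ (k 0) (map k s) c).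
  - exact: ltW.
  - by rewrite path_map.
  - by rewrite chain_length_map.
  - rewrite -map_cons all_map; case: ps => _; apply: sub_all => t /= t01.
    by have := ok t t01; have := dtri c a (k t); lra.
  - by rewrite last_map s1 k0 k1.
have i0 : 0 < (2^-1 : R) ^+ N by rewrite exprn_gt0// invr_gt0.
have -> : poly_sum d k (0 :: s) / 2 * 2^-1 ^+ N = poly_sum d k (0 :: s) / 2 ^+ N.+1.
  by rewrite exprS exprVn invfM mulrA.
move=> H.
have : 1 <= poly_sum d k (0 :: s) / 2 ^+ N.+1 + e by nra.
rewrite /e addrCA lerDl -mulrBl => H'.
by move: H'; rewrite pmulr_lge0 ?invr_gt0// subr_ge0.
Qed.

(** * Short paths near the sphere and geodesics through the ball *)

Lemma dS_short (r : R) p x y e : d x y <= e -> r + e <= d p x \/ r + e <= d p y ->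
  (dS d r p x y <= e%:E)%E.
Proof.
move=> xye rp; have [g gg] := geod_d x y; have xy0 := dge0 x y.
have [g0 [g1 gi]] := gg.
pose k t := g (t * d x y).
have -> : x = k 0 by rewrite /k mul0r.
have -> : y = k 1 by rewrite /k mul1r.
apply: (le_trans (y := (d x y)%:E)); last by rewrite lee_fin.
apply: dS_lipschitz => // [s t ? ?|t t01].
  rewrite /k gi; [|nra|nra].
  by rewrite -mulrBl normrM (ger0_norm xy0) mulrC.
(* Every point of the geodesic is within [e] of the endpoint that lies at distance at least [r + e]
   from [p], so it cannot enter the ball. *)
have tx : 0 <= t * d x y <= d x y by nra.
have := geodesic_dist_left gg tx; have := geodesic_dist_right gg tx.
have := dtri (k t) p x; have := dtri (k t) p y.
by rewrite (dsym (k t) x) /k; case: rp; lra.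
Qed.

Lemma dS_radial (r : R) p a g (s t : R) : 0 <= r -> geodesic d p a g ->
  r <= s <= d p a -> r <= t <= d p a -> (dS d r p (g s) (g t) <= `|s - t|%:E)%E.
Proof.
move=> r0 gg hs ht; have [g0 [g1 gi]] := gg.
pose k u := g (s + u * (t - s)).
have -> : g s = k 0 by rewrite /k mul0r addr0.
have -> : g t = k 1 by rewrite /k mul1r addrCA subrr addr0.
apply: dS_lipschitz => // [u v hu hv|u u01].
  rewrite /k gi; [|nra|nra].
  have -> : s + u * (t - s) - (s + v * (t - s)) = - ((s - t) * (u - v)) by ring.
  by rewrite normrN normrM.
by rewrite /k (geodesic_dist_left gg); nra.
Qed.

(** Go out along [g] to radius [r + delta], cross to [h] there by thinness, and come back along [h];
    each leg costs at most [delta]. *)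
Lemma dS_of_gromov (r : R) p a b g h : 0 <= r -> geodesic d p a g -> geodesic d p b h ->
  r + delta <= gromov d p a b -> (dS d r p (g r) (h r) <= (3 * delta)%:E)%E.
Proof.
move=> r0 gg gh rd; have dp := delta_gt0.
have la := gromov_lel p a b; have lb := gromov_ler p a b.
have -> : 3 * delta = delta + delta + delta by ring.
rewrite !EFinD.
apply: le_trans (dS_triangle metric_d _ _ (h (r + delta)) _ _) _; apply: leeD.
  apply: le_trans (dS_triangle metric_d _ _ (g (r + delta)) _ _) _; apply: leeD.
    apply: le_trans (dS_radial r0 gg _ _) _; [lra|lra|].
    by rewrite lee_fin ler0_norm; lra.
  apply: dS_short; first by apply: thin_at gg gh _; lra.
  by left; rewrite (geodesic_dist_left gg); lra.
apply: le_trans (dS_radial r0 gh _ _) _; [lra|lra|].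
by rewrite lee_fin ger0_norm; lra.
Qed.

(** Two points projected from the same apex are covered too, since (a|a)_p is [d p a], which
    dominates (a|b)_p. *)
Lemma dproj_of_gromov (r : R) p a b : 0 <= r -> r + delta <= gromov d p a b ->
  (dproj d r (sproj d r) p a b <= (3 * delta)%:E)%E.
Proof.
move=> r0 rab; have dp := delta_gt0; have rba := rab; rewrite gromov_sym in rba.
have ra := gromov_lel p a b; have rb := gromov_ler p a b.
apply: diamS_le => _ _ [[g [gg <-]]|[g [gg <-]]] [[h [gh <-]]|[h [gh <-]]];
  apply: dS_of_gromov gg gh _ => //; rewrite gromov_diag; lra.
Qed.

Lemma dS_through_ball (r : R) a b c g h k (t : R) : 2 <= r ->
  geodesic d a b g -> geodesic d a c h -> geodesic d b c k ->
  0 <= t <= d b c -> d (k t) a <= 1 -> r + delta <= d a b -> r + delta <= d a c ->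
  ((powR 2 ((r - 2) / delta) - 4 * delta)%:E <= dS d r a (g r) (h r))%E.
Proof.
move=> r2 gg gh gk t01 ka rb rc; have dp := delta_gt0.
have tb := geodesic_dist_left gk t01; have tc := geodesic_dist_right gk t01.
have abt := dtri (k t) a b; have act := dtri (k t) a c.
rewrite (dsym a (k t)) in abt act; rewrite (dsym (k t) b) tb in abt; rewrite tc in act.
have abc := dtri a b c; rewrite (dsym b a) in abc.
(* Since [k] passes within 1 of [a], the product (b|c)_a is at most 1. Thus the points of [g] and
   [h] at radius [r + delta] lie beyond the centre of the tripod and are matched with points [u],
   [v] of [k] on either side of [k t]. *)
pose s := d a b - (r + delta); pose s' := d a c - (r + delta).
pose u := k s; pose v := k (d b c - s').
have ux : d (g (r + delta)) u <= delta.
  have := @thin_at _ _ _ _ _ s (geodesic_rev gg) gk.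
  by rewrite /s opprB addrCA subrr addr0; apply; rewrite /gromov (dsym b a); lra.
have vy : d (h (r + delta)) v <= delta.
  have := @thin_at _ _ _ _ _ s' (geodesic_rev gh) (geodesic_rev gk).
  rewrite (_ : d a c - s' = r + delta); last by rewrite /s'; ring.
  apply.
  by rewrite /gromov /s' (dsym c a) (dsym c b); lra.
have suv : on_segment u v (k t) by apply: on_subsegment gk _ _ _ _; rewrite /s /s'; lra.
have ak : d a (k t) <= 1 by rewrite dsym.
have dx := geodesic_dist_left gg (t := r + delta) ltac:(lra).
have dy := geodesic_dist_left gh (t := r + delta) ltac:(lra).
have uv := dS_exp_lower_bound r2 suv ak.
have r0 : 0 <= r by lra.
have ux' : (dS d r a u (g (r + delta)%R) <= delta%:E)%E.
  by apply: dS_short; [rewrite dsym|right; rewrite dx].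
have xx : (dS d r a (g (r + delta)%R) (g r) <= delta%:E)%E.
  apply: le_trans (dS_radial r0 gg _ _) _; [lra|lra|].
  by rewrite lee_fin ger0_norm; lra.
have yy : (dS d r a (h r) (h (r + delta)%R) <= delta%:E)%E.
  apply: le_trans (dS_radial r0 gh _ _) _; [lra|lra|].
  by rewrite lee_fin ler0_norm; lra.
have yv : (dS d r a (h (r + delta)%R) v <= delta%:E)%E.
  by apply: dS_short => //; left; rewrite dy.
have : ((powR 2 ((r - 2) / delta)%R)%:E <=
    delta%:E + (delta%:E + (dS d r a (g r) (h r) + (delta%:E + delta%:E))))%E.
  apply: le_trans uv _.
  apply: le_trans (dS_triangle metric_d _ _ (g (r + delta)) _ _) _; apply: leeD.
    exact: ux'.
  apply: le_trans (dS_triangle metric_d _ _ (g r) _ _) _; apply: leeD => //.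
  apply: le_trans (dS_triangle metric_d _ _ (h r) _ _) _; apply: leeD => //.
  by apply: le_trans (dS_triangle metric_d _ _ (h (r + delta)) _ _) _; apply: leeD.
case: (dS d r a (g r) (h r)) (dS_ge0 d r a (g r) (h r)) => [q| |]//=.
  by rewrite -!EFinD !lee_fin => _; lra.
by move=> _ _; rewrite leey.
Qed.

End Hyperbolic.

(** * The projection axioms for separated apices *)

Section Apices.
Context {R : realType} {X : Type} (d : X -> X -> R) (delta r : R) (C : set X).
Context (metric_d : is_metric d) (geod_d : geodesic_space d).
Context (delta_gt0 : 0 < delta) (hyp_d : hyperbolic d delta) (r_ge0 : 0 <= r).
Context (sep_C : rho_separated d (2 * r + 6 * delta) C).

Local Notation dsym := (dist_sym metric_d).
Local Notation dtri := (dist_triangle metric_d).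
Local Notation pi := (sproj d r).

Lemma gromov_lt_of_dproj p a b :
  ((3 * delta)%:E < dproj d r pi p a b)%E -> gromov d p a b < r + delta.
Proof.
rewrite !ltNge => /negP H; apply/negP => rab; apply: H.
exact: (dproj_of_gromov metric_d geod_d delta_gt0 hyp_d).
Qed.

Lemma diam_sproj_le p a : C p -> C a -> a <> p ->
  (diamS d r p (pi p a) <= (3 * delta)%:E)%E.
Proof.
move=> Cp Ca ap; have dp := delta_gt0; have r0 := r_ge0.
have := sep_C Ca Cp ap; rewrite dsym => pa.
apply: le_trans (_ : (dproj d r pi p a a <= _)%E).
  by apply: diamS_subset => x ?; left.
apply: (dproj_of_gromov metric_d geod_d delta_gt0 hyp_d) => //.
by rewrite (gromov_diag metric_d); lra.
Qed.

(** By separation, a product (x|z)_y below [r + delta] leaves more than [r + 5 * delta] for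
    (y|z)_x. *)
Lemma behrstock x y z : C x -> C y -> x <> y ->
  ((3 * delta)%:E < dproj d r pi y x z)%E ->
  (dproj d r pi x y z <= (3 * delta)%:E)%E.
Proof.
move=> Cx Cy xy /gromov_lt_of_dproj xz; have dp := delta_gt0; have r0 := r_ge0.
apply: (dproj_of_gromov metric_d geod_d delta_gt0 hyp_d) => //.
by have := sep_C Cx Cy xy; rewrite (gromov_compl metric_d); lra.
Qed.

(* Such an apex [y] lies within r + 2 delta of the point at distance (y|z)_x
   from [x] on a geodesic [x,z]; separation keeps these points more than
   delta apart. *)
Lemma finite_large_projections x z :
  finite_set [set y | C y /\ y <> x /\ y <> z /\
    ((3 * delta)%:E < dproj d r pi y x z)%E].
Proof.
set A := [set y | _]; have dp := delta_gt0; have r0 := r_ge0.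
have [g gg] := geod_d x z; have [g0 [g1 gi]] := gg.
(* The point of the geodesic from [x] to [y] at the same distance from [x] is at distance (x|z)_y
   from [y]; thinness adds [delta]. *)
have near y : A y -> d y (g (gromov d x y z)) <= r + 2 * delta.
  move=> [_ [_ [_ /gromov_lt_of_dproj yxz]]]; have [h hh] := geod_d x y.
  have t0 := gromov_ge0 metric_d x y z; have ty := gromov_lel metric_d x y z.
  have := thin_at metric_d geod_d hyp_d hh gg (t := gromov d x y z) ltac:(lra).
  have := geodesic_dist_right metric_d hh (t := gromov d x y z) ltac:(lra).
  have := dtri (h (gromov d x y z)) y (g (gromov d x y z)).
  rewrite (dsym y (h _)); move: yxz; rewrite (gromov_compl metric_d y x z) (dsym y x).
  by lra.
(* Equal values of [f] would put two distinct apices at distance at most [2 * r + 5 * delta], below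
   the separation. *)
pose f y := Num.trunc (gromov d x y z / delta).
have finj : {in A &, injective f}.
  move=> y y' /set_mem Ay /set_mem Ay' fyy'; apply: contrapT => yy'.
  have t0 := gromov_ge0 metric_d x y z; have t0' := gromov_ge0 metric_d x y' z.
  have tz := gromov_ler metric_d x y z; have tz' := gromov_ler metric_d x y' z.
  have q0 : 0 <= gromov d x y z / delta by rewrite divr_ge0// ltW.
  have q0' : 0 <= gromov d x y' z / delta by rewrite divr_ge0// ltW.
  have /andP[b1 b2] := truncn_itv q0; have /andP[b1' b2'] := truncn_itv q0'.
  rewrite -/(f y) in b1 b2; rewrite -/(f y') -fyy' in b1' b2'.
  move: b1 b2 b1' b2'; rewrite !(ler_pdivlMr _ _ dp) !(ltr_pdivrMr _ _ dp) -natr1.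
  rewrite mulrDl mul1r; move: (_ * delta) => m b1 b2 b1' b2'.
  have : `|gromov d x y z - gromov d x y' z| <= delta by rewrite ler_distlC; lra.
  rewrite -gi; [|lra|lra].
  have := sep_C Ay.1 Ay'.1 yy'; have := near _ Ay; have := near _ Ay'.
  set u := g (gromov d x y z); set v := g (gromov d x y' z).
  by have := dtri v y y'; have := dtri u y v; rewrite (dsym v y'); lra.
rewrite -(eq_finite_set (inj_card_eq finj)).
apply: (@sub_finite_set _ _ `I_(Num.trunc (d x z / delta)).+1); last exact: finite_II.
move=> _ [y Ay <-] /=; rewrite ltnS; apply: le_truncn.
by rewrite ler_pM2r ?invr_gt0// gromov_ler.
Qed.

Lemma sproj_projection_axioms : projection_axioms d r C pi (3 * delta).
Proof.
split; [exact: diam_sproj_le|split=> [x y z Cx Cy Cz xy yz xz|x z _ _]].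
  exact: behrstock.
exact: finite_large_projections.
Qed.

(** * Shadows, zigzags and the upgraded projections *)

Definition shadow_adj (y u v : X) : Prop :=
  gromov d u y v < r + delta \/ gromov d v y u < r + delta.

(** The product is at least half of [d w M]. Hence no apex has a nearer one in its shadow. *)
Lemma gromov_closer M w y : C M -> C w -> M <> w -> d y M <= d y w ->
  r + 3 * delta <= gromov d w y M.
Proof.
move=> CM Cw Mw; have := sep_C CM Cw Mw.
by rewrite /gromov (dsym w y) (dsym w M) (dsym y M); lra.
Qed.

(* The loss delta is not accumulated along a zigzag: the projections of [w1] and
   [w] to the sphere about [M] are both close to that of [M2]. *)
Lemma shadow_step y M M2 w1 w : C M -> C M2 -> C w1 ->
  d y M <= d y M2 -> d y M <= d y w1 -> shadow_adj y M w1 ->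
  gromov d M2 y w1 < r + 2 * delta -> gromov d M2 y w < r + 2 * delta ->
  gromov d M y w < r + 2 * delta.
Proof.
move=> CM CM2 Cw1 yM2 yw1 adj M2w1 M2w; have dp := delta_gt0; have r0 := r_ge0.
have [<-//|MM2] := pselect (M2 = M).
have sep := sep_C CM2 CM MM2.
have far : r + 3 * delta <= gromov d M2 y M by apply: gromov_closer => // /esym.
have Mw1 : gromov d M y w1 < r + delta.
  case: adj => // w1M; have [<-|Mw1] := pselect (M = w1).
    by rewrite (gromov_base metric_d); lra.
  by have := gromov_closer CM Cw1 Mw1 yw1; lra.
(* As seen from [M2], [M] lies in the direction of [y]; so whatever is behind [M2] for [y] is also
   behind [M2] for [M]. *)
have beyond v : gromov d M2 y v < r + 2 * delta -> r + 3 * delta <= gromov d M M2 v.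
  move=> M2v; rewrite (gromov_compl metric_d) (dsym M).
  suff : gromov d M2 M v < r + 2 * delta + delta by lra.
  rewrite (gromov_sym metric_d).
  apply: (gromov_lt_of_close metric_d geod_d hyp_d (z := y)).
    by rewrite (gromov_sym metric_d); lra.
  by rewrite (gromov_sym metric_d).
suff : gromov d M y w < r + delta + delta by lra.
apply: (gromov_lt_of_close metric_d geod_d hyp_d (z := w1)) => //.
apply: le_trans (four_point metric_d geod_d hyp_d M2 M w w1).
have := beyond _ M2w1; have := beyond _ M2w; rewrite (gromov_sym metric_d M M2 w).
by move=> h1 h2; rewrite lerBrDr le_min; apply/andP; split; lra.
Qed.

Lemma nearest_index y (w : nat -> X) i n : exists2 k, (i <= k <= i + n)%N &
  forall l, (i <= l <= i + n)%N -> d y (w k) <= d y (w l).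
Proof.
elim: n => [|n [k kn Hk]].
  by exists i => [|l]; [lia|rewrite addn0 -eqn_leq => /eqP ->].
have [le|lt] := lerP (d y (w k)) (d y (w (i + n.+1)%N)).
  exists k => [|l ln]; first lia.
  have [->//|ne] := eqVneq l (i + n.+1)%N; apply: Hk; lia.
exists (i + n.+1)%N => [|l ln]; first lia.
have [->//|ne] := eqVneq l (i + n.+1)%N.
by apply: le_trans (ltW lt) _; apply: Hk; lia.
Qed.

(** Strong induction on the length: removing the nearest member [w k] leaves two shorter zigzags.
    The one containing [w l] has its own nearest member [w k2], and its end adjacent to [w k] serves
    as the linking apex in [shadow_step]. *)
Lemma zigzag_shadow y (w : nat -> X) n i :
  (forall l, (i <= l <= i + n)%N -> C (w l)) ->
  (forall l, (i <= l < i + n)%N -> shadow_adj y (w l) (w l.+1)) ->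
  exists2 k, (i <= k <= i + n)%N & forall l, (i <= l <= i + n)%N ->
    d y (w k) <= d y (w l) /\ gromov d (w k) y (w l) < r + 2 * delta.
Proof.
have dp := delta_gt0; have r0 := r_ge0.
elim/ltn_ind: n i => n IH i Cw adj.
have [k kn Hk] := nearest_index y w i n; exists k => // l ln; split; first exact: Hk.
have [lk|kl|->] := ltngtP l k; last first.
- by rewrite (gromov_base metric_d); lra.
- have [|l1 ?|l1 ?|k2 k2n Hk2] := IH (i + n - k.+1)%N _ k.+1.
  + lia.
  + apply: Cw; lia.
  + apply: adj; lia.
  + apply: (@shadow_step y (w k) (w k2) (w k.+1)).
    * apply: Cw; lia.
    * apply: Cw; lia.
    * apply: Cw; lia.
    * apply: Hk; lia.
    * apply: Hk; lia.
    * apply: adj; lia.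
    * apply: (Hk2 k.+1 _).2; lia.
    * apply: (Hk2 l _).2; lia.
- have [|l1 ?|l1 ?|k2 k2n Hk2] := IH (k.-1 - i)%N _ i.
  + lia.
  + apply: Cw; lia.
  + apply: adj; lia.
  + apply: (@shadow_step y (w k) (w k2) (w k.-1)).
    * apply: Cw; lia.
    * apply: Cw; lia.
    * apply: Cw; lia.
    * apply: Hk; lia.
    * apply: Hk; lia.
    * suff : shadow_adj y (w k.-1) (w k.-1.+1) by rewrite prednK; [case; [right|left]|lia].
      apply: adj; lia.
    * apply: (Hk2 k.-1 _).2; lia.
    * apply: (Hk2 l _).2; lia.
Qed.

Definition linked (y a b : X) : Prop :=
  exists (n : nat) (w : nat -> X), [/\ w 0 = a, w n = b,
    forall l, (l <= n)%N -> C (w l) /\ w l <> y &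
    forall l, (l < n)%N -> shadow_adj y (w l) (w l.+1)].

Lemma linked_refl y a : C a -> a <> y -> linked y a a.
Proof. by move=> Ca ay; exists 0%N, (fun=> a). Qed.

Lemma linked_cons y u a b : C u -> u <> y -> shadow_adj y u a ->
  linked y a b -> linked y u b.
Proof.
move=> Cu uy ua [n [w [wa wb Cw adj]]].
exists n.+1, (fun l => if l is l'.+1 then w l' else u); split=> //.
  by case=> [|l] // ln; apply: Cw.
by case=> [|l] // ln; [rewrite wa|apply: adj].
Qed.

(** Seen from [y], both ends have a large product with the nearest member of the zigzag, so the
    four-point inequality is used only once, whatever the length. *)
Lemma linked_gromov y a b : C y -> linked y a b -> r + delta <= gromov d y a b.
Proof.
move=> Cy [n [w [<- <- Cw adj]]]; have dp := delta_gt0; have r0 := r_ge0.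
have [||k kn Hk] := @zigzag_shadow y w n 0.
- by move=> l ln; apply: (Cw l _).1; lia.
- by move=> l ln; apply: adj; lia.
have [Ck ky] := Cw k ltac:(lia).
have sep := sep_C Ck Cy ky.
have close l : (l <= n)%N -> r + 2 * delta <= gromov d y (w k) (w l).
  move=> ln; rewrite (gromov_compl metric_d) (dsym y).
  by have [_] := Hk l ltac:(lia); lra.
apply: le_trans (four_point metric_d geod_d hyp_d (w k) y (w 0%N) (w n)).
have := close 0%N isT; have := close n (leqnn n).
rewrite (gromov_sym metric_d y (w k) (w 0%N)) => h1 h2.
by rewrite lerBrDr le_min; apply/andP; split; lra.
Qed.

Definition upgraded_proj (p a : X) : set X :=
  [set x | exists w, linked p a w /\ pi p w x].
Local Notation pi' := upgraded_proj.

Lemma sproj_sub_upgraded p a : C a -> a <> p -> pi p a `<=` pi' p a.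
Proof. by move=> Ca ap x pix; exists a; split=> //; apply: linked_refl. Qed.

Lemma upgraded_adj p u v : C u -> C v -> u <> p -> v <> p ->
  shadow_adj p u v -> pi' p u = pi' p v.
Proof.
move=> Cu Cv up vp uv; apply/seteqP.
split=> x [w [lw piw]]; exists w; split=> //.
  by apply: linked_cons lw => //; case: uv; [right|left].
exact: linked_cons lw.
Qed.

Lemma upgraded_sub_sphere p a : C p -> pi' p a `<=` sphere d r p.
Proof.
move=> Cp _ [w [[n [w' [_ <- Cw _]]] [g [gg <-]]]] /=.
have [Cn np] := Cw n (leqnn n); have dp := delta_gt0; have r0 := r_ge0.
have := sep_C Cn Cp np; rewrite dsym => sep.
by rewrite /sphere /= dsym (geodesic_dist_left metric_d gg); lra.
Qed.

(** Both orders are recorded because a path between two upgraded points starts with one such leg and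
    ends with the reverse of another. *)
Lemma upgraded_near p a x : C p -> pi' p a x -> exists2 x0, pi p a x0 &
  (dS d r p x x0 <= (3 * delta)%:E)%E /\ (dS d r p x0 x <= (3 * delta)%:E)%E.
Proof.
move=> Cp [w [lw [g [gg <-]]]]; have [h gh] := geod_d p a.
have aw := linked_gromov Cp lw; have wa := aw.
rewrite (gromov_sym metric_d) in wa.
exists (h r); first by exists h.
by split; apply: (dS_of_gromov metric_d geod_d delta_gt0 hyp_d); eassumption.
Qed.

Lemma dproj_le_upgraded p a b : C a -> C b -> a <> p -> b <> p ->
  (dproj d r pi p a b <= dproj d r pi' p a b)%E.
Proof.
by move=> Ca Cb ap bp; apply: diamS_subset; apply: setUSS; apply: sproj_sub_upgraded.
Qed.

Lemma upgraded_dproj_le p a b : C p ->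
  (dproj d r pi' p a b <= dproj d r pi p a b + (2 * (3 * delta))%:E)%E.
Proof.
move=> Cp; have dp := delta_gt0.
have near x : (pi' p a `|` pi' p b) x -> exists2 x0, (pi p a `|` pi p b) x0 &
    (dS d r p x x0 <= (3 * delta)%:E)%E /\ (dS d r p x0 x <= (3 * delta)%:E)%E.
  by case=> /(upgraded_near Cp)[x0 ? ?]; exists x0 => //; [left|right].
apply: diamS_le => x y /near[x0 Ax0 [xx0 _]] /near[y0 Ay0 [_ y0y]].
apply: le_trans (dS_triangle metric_d _ _ x0 _ _) _.
rewrite (_ : 2 * (3 * delta) = 3 * delta + 3 * delta); last by ring.
rewrite EFinD addeCA; apply: leeD => //.
apply: le_trans (dS_triangle metric_d _ _ y0 _ _) _.
by apply: leeD => //; apply: dS_le_diam.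
Qed.

(** The constant is [3 * delta] for the original projections plus the upgrade error
    [2 * (3 * delta)]. *)
Lemma large_upgraded_dproj (t : R) p a b : C p -> 9 * delta <= t ->
  (t%:E < dproj d r pi' p a b)%E -> ((3 * delta)%:E < dproj d r pi p a b)%E.
Proof.
move=> Cp tdelta H; rewrite ltNge; apply/negP => small.
have := lt_le_trans H (upgraded_dproj_le a b Cp).
apply/negP; rewrite -leNgt; apply: le_trans (leeD small (lexx _)) _.
by rewrite -EFinD lee_fin; lra.
Qed.

Lemma upgraded_strong_axioms (t : R) : 9 * delta <= t ->
  strong_projection_axioms d r C pi' t.
Proof.
move=> tdelta; have dp := delta_gt0; split=> [p a Cp Ca ap|].
  apply: le_trans (_ : (dproj d r pi' p a a <= _)%E).
    by apply: diamS_subset => x ?; left.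
  apply: le_trans (upgraded_dproj_le a a Cp) _.
  rewrite /dproj setUid.
  apply: le_trans (leeD (diam_sproj_le Cp Ca ap) (lexx _)) _.
  by rewrite -EFinD lee_fin; lra.
split=> [x y z w Cx Cy Cz Cw xy xz xw yz yw zw|x z Cx Cz].
  (* A large distance at [x] puts [z] in the shadow of [x] as seen from [y], so [x] and [z] have
     literally the same upgraded projection to [y]. *)
  move=> /(large_upgraded_dproj Cx tdelta)/gromov_lt_of_dproj xyz.
  rewrite /dproj; congr (diamS d r y (_ `|` _)).
  by apply: upgraded_adj => //; [move/esym|right].
apply: sub_finite_set (finite_large_projections x z) => y [Cy [yx [yz H]]].
by split=> //; split=> //; split=> //; apply: large_upgraded_dproj H.
Qed.

End Apices.

(** * Equivariance of the construction *)

Section Isometries.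
Context {R : realType} {X : Type} (d : X -> X -> R) (delta r : R) (C : set X).

Definition preserves (f : X -> X) : Prop :=
  (forall x y, d (f x) (f y) = d x y) /\ (forall x, C x -> C (f x)).

Lemma gromov_preserves f x y z : preserves f ->
  gromov d (f x) (f y) (f z) = gromov d x y z.
Proof. by move=> [fi _]; rewrite /gromov !fi. Qed.

Lemma linked_preserves f y a b : injective f -> preserves f ->
  linked d delta r C y a b -> linked d delta r C (f y) (f a) (f b).
Proof.
move=> finj pf [n [w [<- <- Cw adj]]]; exists n, (f \o w); split=> // l ln.
  by have [Cl ly] := Cw l ln; split=> [|/finj//]; apply: pf.2.
by have := adj l ln; rewrite /shadow_adj /= !gromov_preserves.
Qed.

Lemma sproj_preserves f p a x : preserves f ->
  sproj d r p a x -> sproj d r (f p) (f a) (f x).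
Proof.
move=> [fi _] [g [[g0 [g1 gi]] <-]]; exists (f \o g); split=> //.
by rewrite /geodesic fi /= g0 g1; split=> //; split=> // s t ? ?; rewrite fi gi.
Qed.

Lemma upgraded_preserves f p a x : injective f -> preserves f ->
  upgraded_proj d delta r C p a x -> upgraded_proj d delta r C (f p) (f a) (f x).
Proof.
move=> finj pf [w [lw piw]]; exists (f w).
by split; [apply: linked_preserves|apply: sproj_preserves].
Qed.

Lemma dS_preserves f p x y : preserves f ->
  (dS d r (f p) (f x) (f y) <= dS d r p x y)%E.
Proof.
move=> [fi _]; apply/ereal_infP => _ [g [cg [g0 [g1 og]]] <-].
have -> : path_length d g = path_length d (f \o g).
  rewrite /path_length; congr ereal_sup; apply: eq_imagel => s _.
  by congr EFin; apply: eq_bigr => i _; rewrite /= fi.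
apply: dS_le_length; rewrite /outside_path /= g0 g1; split; last first.
  by split=> //; split=> // t t01; rewrite fi; apply: og.
move=> s s01 e e0; have [q q0 Hq] := cg s s01 e e0.
by exists q => // t t01 st; rewrite /= fi; apply: Hq.
Qed.

Context (f h : X -> X) (fK : cancel f h) (hK : cancel h f).
Context (pf : preserves f) (ph : preserves h) (K : R).
Local Notation pi' := (upgraded_proj d delta r C).

(** Points of the projections at [f p] are pulled back by the inverse [h], and [f] does not increase
    the path metric. *)
Lemma upgraded_dproj_preserves p a b :
  (dproj d r pi' (f p) (f a) (f b) <= dproj d r pi' p a b)%E.
Proof.
have pull x : (pi' (f p) (f a) `|` pi' (f p) (f b)) x -> (pi' p a `|` pi' p b) (h x).
  by case=> /(upgraded_preserves (can_inj hK) ph); rewrite !fK; [left|right].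
apply: diamS_le => x y /pull Ax /pull Ay.
rewrite -(hK x) -(hK y); apply: le_trans (dS_preserves _ _ _ pf) _.
exact: dS_le_diam.
Qed.

Lemma pc_adj_preserves p q : pc_adj d r C pi' K p q -> pc_adj d r C pi' K (f p) (f q).
Proof.
move=> [Cp [Cq [pq H]]]; split; first exact: pf.2.
split; first exact: pf.2.
split=> [/(can_inj fK)//|y Cy yp yq].
rewrite -(hK y); apply: le_trans (upgraded_dproj_preserves _ _ _) _.
by apply: H; [exact: ph.2|move=> e; apply: yp; rewrite -e hK|
  move=> e; apply: yq; rewrite -e hK].
Qed.

Lemma pc_within_preserves n p q :
  pc_within d r C pi' K n p q -> pc_within d r C pi' K n (f p) (f q).
Proof.
elim: n p => [|n IH] p /=; first by move=> [Cp <-]; split=> //; apply: pf.2.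
move=> [[Cp <-]|[y [py yq]]]; first by left; split=> //; apply: pf.2.
by right; exists (f y); split; [apply: pc_adj_preserves|apply: IH].
Qed.

End Isometries.

(** * The action on the projection complex and the spinning estimate *)

Unset Implicit Arguments.

Theorem theorem3p2 (R : realType) (X : Type) (d : X -> X -> R)
  (G : Type) (mul : G -> G -> G) (one : G) (inv : G -> G) (act : G -> X -> X)
  (C : set X) (Gc : X -> set G) (delta rho r theta : R) :
  is_metric d -> geodesic_space d -> 0 < delta -> hyperbolic d delta ->
  is_group mul one inv -> isometric_action mul one d act ->
  rotating_family mul one inv act C Gc -> rho_separated d rho C ->
  fairly_rotating one d act C Gc -> 20 * delta <= rho ->
  2 + 2 * delta <= r -> r <= rho / 2 - 3 * delta ->
  121 * delta <= theta ->
  exists (pi' : X -> X -> set X),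
    (* pi' is an upgrade of the projection data (Y, pi) *)
    (exists theta0 : R,
       projection_axioms d r C (sproj d r) theta0 /\ 11 * theta0 <= theta /\
       (forall p a, C p -> C a -> a <> p -> pi' p a `<=` sphere d r p) /\
       (forall p a b, C p -> C a -> C b -> a <> p -> b <> p ->
          (dproj d r (sproj d r) p a b - (2 * theta0)%:E <= dproj d r pi' p a b)%E /\
          (dproj d r pi' p a b <= dproj d r (sproj d r) p a b + (2 * theta0)%:E)%E)) /\
    strong_projection_axioms d r C pi' theta /\
    (* G acts by isometries on the projection complex P(Y, theta, K) *)
    (forall K, 3 * theta <= K -> forall g n p q, C p -> C q ->
       pc_within d r C pi' K n p q <-> pc_within d r C pi' K n (act g p) (act g q)) /\
    (* {G_c} is an L-spinning family, L = 2^((r-2)/delta) - 4 - 248 delta *)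
    (forall a b g, C a -> C b -> a <> b -> Gc a g -> g <> one ->
       ((powR 2 ((r - 2) / delta) - 4 - 248 * delta)%:E
          <= dproj d r pi' a b (act g b))%E).
Proof.
move=> metric_d geod_d delta_gt0 hyp_d [mulA [mul1 mulV]] [act1 [actM acti]].
move=> [actC [_ [fixGc _]]] sep fair rho_ge r_ge r_le theta_ge.
have r0 : 0 <= r by lra.
have sepC : rho_separated d (2 * r + 6 * delta) C.
  by move=> c c' Cc Cc' cc'; apply: le_trans (sep _ _ Cc Cc' cc'); lra.
have mulVr g : mul g (inv g) = one.
  have e : mul (inv (inv g)) one = g by rewrite -(mulV g) mulA mulV mul1.
  by rewrite -{1}e -mulA mul1 mulV.
have actK g : cancel (act g) (act (inv g)) by move=> x; rewrite -actM mulV act1.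
have actVK g : cancel (act (inv g)) (act g) by move=> x; rewrite -actM mulVr act1.
have pres g : preserves d C (act g) by split; [exact: acti|move=> x; apply: actC].
exists (upgraded_proj d delta r C); split; [|split; [|split]].
(* With this [theta0] the required bound reads [33 * delta <= theta]. *)
- exists (3 * delta); split; first exact: sproj_projection_axioms.
  split; first by lra.
  split=> [p a Cp _ _|p a b Cp Ca Cb ap bp].
    exact: (upgraded_sub_sphere metric_d delta_gt0).
  split; last exact: (upgraded_dproj_le metric_d geod_d delta_gt0 hyp_d r0 sepC).
  apply: le_trans (dproj_le_upgraded d delta r Ca Cb ap bp).
  by rewrite leeBlDr// leeDl// lee_fin; lra.
- by apply: (upgraded_strong_axioms metric_d geod_d delta_gt0 hyp_d r0 sepC); lra.
- move=> K _ g n p q Cp Cq; split=> H.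
    exact: (pc_within_preserves (actK g) (actVK g) (pres g) (pres (inv g))).
  rewrite -(actK g p) -(actK g q).
  exact: (pc_within_preserves (actVK g) (actK g) (pres (inv g)) (pres g)).
- move=> a b g Ca Cb ab ga g1.
  have ba : b <> a by move/esym.
  have Cgb : C (act g b) := actC g b Cb.
  have gba : act g b <> a.
    by move=> e; apply: ba; rewrite -(actK g b) e -{1}(fixGc a g Ca ga) actK.
  have [k [gk [t t01 ka]]] := fair a g b Ca ga g1 Cb ba.
  have [u gu] := geod_d a b; have [v gv] := geod_d a (act g b).
  have db := sepC _ _ Ca Cb ab; have dgb := sepC _ _ Ca Cgb (nesym gba).
  (* The upgrade only enlarges projections, so the lower bound carries over without loss. *)
  apply: le_trans (dproj_le_upgraded d delta r Cb Cgb ba gba).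
  apply: le_trans (_ : (dS d r a (u r) (v r) <= _)%E); last first.
    by apply: dS_le_diam; [left; exists u|right; exists v].
  have [r2 rb rgb] : [/\ 2 <= r, r + delta <= d a b & r + delta <= d a (act g b)].
    by split; lra.
  (* Only [4 * delta] is subtracted from the exponential here, which is stronger than the stated
     [L]. *)
  apply: le_trans (dS_through_ball metric_d geod_d delta_gt0 hyp_d r2 gu gv gk t01 ka rb rgb).
  by rewrite lee_fin; lra.
Qed.
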